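(* Let $M$ be a $4$-dimensional Riemannian manifold with a metric $g$ and an affinor structure (i.e. a $(1,1)$-tensor field) $q$ whose components in the local coordinate system $(x^1,x^2,x^3,x^4)$ are $$(g_{ij})=\begin{pmatrix} A & B & C & B\\ B & A & B & C\\ C & B & A & B\\ B & C & B & A\end{pmatrix},\qquad (q_i^{.j})=\begin{pmatrix} 0&1&0&0\\0&0&1&0\\0&0&0&1\\1&0&0&0\end{pmatrix},$$ where $A,B,C$ are smooth functions with $A>C>B>0$. Let $\nabla$ be the Riemannian (Levi-Civita) connection of $g$. Then $\nabla q=0$ if and only if $$\mathrm{grad}\,A=(\mathrm{grad}\,C)\,q^2\quad\text{and}\quad 2\,\mathrm{grad}\,B=(\mathrm{grad}\,C)(q+q^3).$$
   Context: The coordinates $(x^1,x^2,x^3,x^4)$ range over an open set $F\subset\mathbb{R}^4$, and $A,B,C$ are smooth real-valued functions of the point $p=(x^1,x^2,x^3,x^4)\in F$; all assertions are understood on this coordinate domain. The condition $A>C>B>0$ ensures that $g$ is positive definite. In $q_i^{.j}$ the lower index $i$ is the row index and the upper index $j$ is the column index, so $q$ acts on vector fields by $(qu)^j=\sum_i q_i^{.j}u^i$. For a smooth function $\Phi$ on $F$, $\mathrm{grad}\,\Phi$ denotes the row vector of partial derivatives $(\Phi_1,\Phi_2,\Phi_3,\Phi_4)$, $\Phi_i=\partial\Phi/\partial x^i$ (not the metric gradient), and $(\mathrm{grad}\,C)q^2$, $(\mathrm{grad}\,C)(q+q^3)$ are products of this row vector with the matrices $q^2$ and $q+q^3$, where $q$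 is the $4\times4$ matrix $(q_i^{.j})$ displayed in the claim. $\nabla q=0$ means $\nabla_i q_j^{s}=\partial_i q_j^{s}+\sum_k\Gamma_{ik}^{s}q_j^{k}-\sum_k\Gamma_{ij}^{k}q_k^{s}=0$ for all $i,j,s$, where $\Gamma_{ij}^s$ are the Christoffel symbols of $\nabla$. *)

(* Defs.v *)
From mathcomp Require Import all_boot all_order all_algebra.
From mathcomp Require Import ring lra.
From mathcomp Require Import all_classical all_reals all_analysis.
Import Order.TTheory GRing.Theory Num.Theory.
Import numFieldNormedType.Exports.

Set Implicit Arguments.
Unset Strict Implicit.
Unset Printing Implicit Defensive.

Local Open Scope classical_set_scope.
Local Open Scope ring_scope.

Section LocalCoordinates.
Context {R : realType} {n : nat}.
Local Notation pt := 'rV[R]_n.+1.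
Local Notation idx := 'I_n.+1.

Definition partial (i : idx) (f : pt -> R) : pt -> R :=
  fun p => 'D_(delta_mx 0 i) f p.

(* Class C^oo on F: every iterated partial derivative exists and is continuous
   at each point of F. *)
Definition smooth_on (F : set pt) (f : pt -> R) : Prop :=
  forall (s : seq idx) (p : pt), F p ->
    {for p, continuous (foldr partial f s)} /\
    (forall i : idx, derivable (foldr partial f s) p (delta_mx 0 i)).

(* The row vector of partial derivatives, not the metric gradient. *)
Definition grad (f : pt -> R) (p : pt) : 'rV[R]_n.+1 := \row_i partial i f p.

(* [christoffel g i j s p] is Gamma_{ij}^s at p for the Levi-Civita connection
   of g; [invmx (g p) a s] is g^{as}.  See [levi_civita_unique]. *)
Definition christoffel (g : pt -> 'M[R]_n.+1) (i j s : idx) (p : pt) : R :=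
  2^-1 * \sum_a (partial i (fun x => g x a j) p
                 + partial j (fun x => g x a i) p
                 - partial a (fun x => g x i j) p) * invmx (g p) a s.

(* [cov_deriv g q i j s p] is nabla_i q_j^s at p, for a (1,1)-tensor field q
   whose matrix has the lower index as row index. *)
Definition cov_deriv (g q : pt -> 'M[R]_n.+1) (i j s : idx) (p : pt) : R :=
  partial i (fun x => q x j s) p
  + \sum_k christoffel g i k s p * q p j k
  - \sum_k christoffel g i j k p * q p k s.

(* Connection coefficients Gamma i j s (= Gamma_{ij}^s) at p which are
   torsion-free and satisfy nabla g = 0 at p. *)
Definition levi_civita_at (g : pt -> 'M[R]_n.+1) (p : pt)
    (Gamma : idx -> idx -> idx -> R) : Prop :=
  (forall i j s, Gamma i j s = Gamma j i s) /\
  (forall i j k, partial i (fun x => g x j k) p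
     - \sum_s Gamma i j s * g p s k - \sum_s Gamma i k s * g p j s = 0).

Lemma levi_civita_unique (g : pt -> 'M[R]_n.+1) (p : pt)
    (gsym : forall x i j, g x i j = g x j i) (gunit : g p \in unitmx)
    (Gamma : idx -> idx -> idx -> R) :
  levi_civita_at g p Gamma <->
  forall i j s, Gamma i j s = christoffel g i j s p.
Proof.
have dsym i j k : partial i (fun x => g x j k) p = partial i (fun x => g x k j) p.
  by congr partial; apply/funext => x; rewrite gsym.
pose low i j k := 2^-1 * (partial i (fun x => g x k j) p
  + partial j (fun x => g x k i) p - partial k (fun x => g x i j) p).
have chE i j s : christoffel g i j s p = ((\row_k low i j k) *m invmx (g p)) 0 s.
  rewrite /christoffel mxE mulr_sumr; apply: eq_bigr => a _.
  by rewrite mxE mulrA.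
have lowE i j k : \sum_s christoffel g i j s p * g p s k = low i j k.
  have -> : \sum_s christoffel g i j s p * g p s k
     = ((\row_k low i j k) *m invmx (g p) *m g p) 0 k.
    by rewrite [RHS]mxE; apply: eq_bigr => s _; rewrite chE.
  by rewrite -mulmxA mulVmx // mulmx1 mxE.
split=> [[Gs Gm] i j s|GE].
  have GmE a b c : partial a (fun x => g x b c) p =
     \sum_s Gamma a b s * g p s c + \sum_s Gamma a c s * g p s b.
    have -> : \sum_s Gamma a c s * g p s b = \sum_s Gamma a c s * g p b s.
      by apply: eq_bigr => t _; rewrite gsym.
    by apply/eqP; rewrite -subr_eq0 opprD addrA Gm.
  have GL k : \sum_s Gamma i j s * g p s k = low i j k.
    rewrite /low !GmE.
    have -> : \sum_s Gamma j k s * g p s i = \sum_s Gamma k j s * g p s i.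
      by apply: eq_bigr => t _; rewrite Gs.
    have -> : \sum_s Gamma k i s * g p s j = \sum_s Gamma i k s * g p s j.
      by apply: eq_bigr => t _; rewrite Gs.
    have -> : \sum_s Gamma j i s * g p s k = \sum_s Gamma i j s * g p s k.
      by apply: eq_bigr => t _; rewrite Gs.
    move: (\sum_s _) (\sum_s _) (\sum_s _) => x y z.
    by lra.
  rewrite chE.
  have -> : \row_k low i j k = (\row_k Gamma i j k) *m g p.
    apply/rowP => k; rewrite !mxE -GL; apply: eq_bigr => t _; by rewrite mxE.
  by rewrite -mulmxA mulmxV // mulmx1 mxE.
have lowG i j k : \sum_s Gamma i j s * g p s k = low i j k.
  by rewrite -lowE; apply: eq_bigr => s _; rewrite GE.
split=> [i j s|i j k].
  rewrite !GE !chE; congr ((_ *m _) _ _); apply/rowP => k; rewrite !mxE /low.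
  by rewrite (dsym k j i) [partial i _ _ + _]addrC.
have -> : \sum_s Gamma i k s * g p j s = low i k j.
  by rewrite -lowG; apply: eq_bigr => s _; rewrite [g p j s]gsym.
rewrite lowG /low (dsym i k j) (dsym j k i) (dsym k j i).
by lra.
Qed.

End LocalCoordinates.

(* The 4x4 matrix with the given list of rows. *)
Definition mx4 (T : nzRingType) (rows : seq (seq T)) : 'M[T]_4 :=
  \matrix_(i < 4, j < 4) nth 0 (nth [::] rows i) j.

Definition circ_metric (R : realType) (A B C : 'rV[R]_4 -> R)
    (p : 'rV[R]_4) : 'M[R]_4 :=
  mx4 [:: [:: A p; B p; C p; B p];
          [:: B p; A p; B p; C p];
          [:: C p; B p; A p; B p];
          [:: B p; C p; B p; A p]].

Definition circ_q (R : realType) : 'M[R]_4 :=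
  mx4 [:: [:: 0; 1; 0; 0];
          [:: 0; 0; 1; 0];
          [:: 0; 0; 0; 1];
          [:: 1; 0; 0; 0]].

(* Main.v *)
(** Write [q] also for the matrix of the affinor.  The matrix of [nabla_i q] is
    [q Gamma_i - Gamma_i q] with [Gamma_i = (Gamma_{ij}^s)_{js} = L_i g^-1 / 2],
    where [L_i] is made of first derivatives of [g].  Since [g] is circulant it
    commutes with [q], hence [nabla_i q = 0] iff [q] commutes with [L_i].  These
    are linear equations in the partial derivatives of [A], [B], [C], equivalent
    to the two gradient identities.  The eigenvalues of [g] are [A + 2 B + C],
    [A - C] (twice) and [A - 2 B + C], all positive. *)
Require Import Defs.
From mathcomp Require Import all_boot all_order all_algebra.
From mathcomp Require Import ring lra.
From mathcomp Require Import all_classical all_reals all_analysis.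
Import Order.TTheory GRing.Theory Num.Theory.
Import numFieldNormedType.Exports.

Local Open Scope classical_set_scope.
Local Open Scope ring_scope.

(** Scalar form of [circ_metric], shared by the metric at a point, its derivatives and its
    inverse. *)
Definition circ4 {T : nzRingType} (a b c : T) : 'M[T]_4 :=
  mx4 [:: [:: a; b; c; b]; [:: b; a; b; c]; [:: c; b; a; b]; [:: b; c; b; a]].

Lemma forall_ord4 (P : 'I_4 -> Prop) :
  (forall i, P i) <->
  [/\ P (inord 0), P (inord 1), P (inord 2) & P (inord 3)].
Proof.
split=> [//|[P0 P1 P2 P3] i]; rewrite -(inord_val i).
by case: i => -[|[|[|[|//]]]] ?.
Qed.

Lemma sum_ord4 (V : nmodType) (f : 'I_4 -> V) :
  \sum_i f i = f (inord 0) + f (inord 1) + f (inord 2) + f (inord 3).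
Proof.
rewrite !big_ord_recr big_ord0 /= add0r.
by congr (f _ + f _ + f _ + f _); apply/val_inj; rewrite /= inordK.
Qed.

Lemma circ4_unit (T : realFieldType) (a b c : T) :
  c < a -> b < c -> 0 < b -> circ4 a b c \in unitmx.
Proof.
move=> ca bc b0.
have ordE (i j : 'I_4) : (i == j) = (i == j :> nat) by [].
have u0 : a + 2 * b + c != 0 by apply/lt0r_neq0; lra.
have v0 : a - c != 0 by apply/lt0r_neq0; lra.
have w0 : a - 2 * b + c != 0 by apply/lt0r_neq0; lra.
pose u := (a + 2 * b + c)^-1; pose v := (a - c)^-1; pose w := (a - 2 * b + c)^-1.
(* The inverse is circulant with eigenvalues [u], [v] (twice), [w]; an inverse discrete Fourier
   transform gives its entries. *)
suff /mulmx1_unit[] : circ4 a b c *m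
  circ4 ((u + 2 * v + w) / 4) ((u - w) / 4) ((u - 2 * v + w) / 4) = 1%:M by [].
apply/matrixP => j k; move: j k; apply/forall_ord4; split; apply/forall_ord4;
  split; rewrite mxE sum_ord4 !mxE ?ordE !inordK //= /u /v /w; field;
  by rewrite ?u0 ?v0 ?w0.
Qed.

Lemma circ_q_mulmx (R : realType) n (M : 'M[R]_(4, n)) :
  circ_q R *m M = \matrix_(j, k) M (inord (nth 0 [:: 1; 2; 3; 0] j)%N) k.
Proof.
apply/matrixP => j k; move: j; apply/forall_ord4; split;
  by rewrite !mxE sum_ord4 !mxE !inordK //=; ring.
Qed.

Lemma mulmx_circ_q (R : realType) m (M : 'M[R]_(m, 4)) :
  M *m circ_q R = \matrix_(j, k) M j (inord (nth 0 [:: 3; 0; 1; 2] k)%N).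
Proof.
apply/matrixP => j k; move: k; apply/forall_ord4; split;
  by rewrite !mxE sum_ord4 !mxE !inordK //=; ring.
Qed.

(** The matrix [circ4 a b c] is a polynomial in q, namely a + b (q + q^3) + c q^2. *)
Lemma circ_q_circ4 (R : realType) (a b c : R) :
  circ_q R *m circ4 a b c = circ4 a b c *m circ_q R.
Proof.
rewrite circ_q_mulmx mulmx_circ_q.
apply/matrixP => j k; move: j k; apply/forall_ord4; split; apply/forall_ord4;
  by split; rewrite !mxE !inordK.
Qed.

(* [lowered a b c i] is the matrix [2 Gamma_{ij,k}] of a metric whose [l]-th
   partial derivative is [circ4 (a 0 l) (b 0 l) (c 0 l)]. *)
Definition lowered {R : realType} (a b c : 'rV[R]_4) (i : 'I_4) : 'M[R]_4 :=
  let dg l := circ4 (a 0 l) (b 0 l) (c 0 l) in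
  \matrix_(j, k) (dg i k j + dg j k i - dg k i j).

Lemma circ_q_lowered (R : realType) (a b c : 'rV[R]_4) :
  (forall i, circ_q R *m lowered a b c i = lowered a b c i *m circ_q R) <->
  a = c *m circ_q R ^+ 2 /\ 2 *: b = c *m (circ_q R + circ_q R ^+ 3).
Proof.
rewrite mulmxDr !exprS expr0 !mulr1 -!mulmxE !mulmxA !mulmx_circ_q.
split=> [comm|[aE bE]].
  have E (i j k : nat) :=
    congr1 (fun M : 'M[R]_4 => M (inord j) (inord k)) (comm (inord i)).
  (* With indices mod 4, entry (i+1, i-1) of the i-th identity reads 2 b_{i+2} = c_{i-1} + c_{i+1},
     so b_{i+1} = b_{i-1}. Entry (i, i-1), taken next, reads b_{i+1} - b_{i-1} = c_i - a_{i+2}, so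
     a_{i+2} = c_i. *)
  move: (E 2 3 1)%N (E 3 0 2)%N (E 0 1 3)%N (E 1 2 0)%N.
  move: (E 2 2 1)%N (E 3 3 2)%N (E 0 0 3)%N (E 1 1 0)%N.
  rewrite !circ_q_mulmx !mulmx_circ_q !mxE !inordK //= => *.
  by split; apply/rowP; apply/forall_ord4; split; rewrite !mxE !inordK //=; lra.
(* Conversely, these eight relations imply all 64 scalar equations, each linear in the entries of
   [a], [b], [c]. *)
move: aE bE => /rowP/forall_ord4[a0 a1 a2 a3] /rowP/forall_ord4[b0 b1 b2 b3].
move=> i; rewrite circ_q_mulmx mulmx_circ_q; apply/matrixP => j k.
move: a0 a1 a2 a3 b0 b1 b2 b3 i j k; rewrite !mxE !inordK //=.
move=> a0 a1 a2 a3 b0 b1 b2 b3.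
(* [lra] compares atoms up to conversion, which is slow on terms with [inord]. *)
apply/forall_ord4; split; apply/forall_ord4; split; apply/forall_ord4; split;
  rewrite !mxE !inordK //=; move: a0 a1 a2 a3 b0 b1 b2 b3;
  move: (a 0 (inord 0)) (a 0 (inord 1)) (a 0 (inord 2)) (a 0 (inord 3));
  move: (b 0 (inord 0)) (b 0 (inord 1)) (b 0 (inord 2)) (b 0 (inord 3));
  move: (c 0 (inord 0)) (c 0 (inord 1)) (c 0 (inord 2)) (c 0 (inord 3));
  by move=> *; lra.
Qed.

Lemma partial_circ_metric (R : realType) (A B C : 'rV[R]_4 -> R) i p a j :
  partial i (fun x => circ_metric A B C x a j) p =
  circ4 (grad A p 0 i) (grad B p 0 i) (grad C p 0 i) a j.
Proof.
have entry f : (forall x, circ_metric A B C x a j = f x) ->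
    partial i (fun x => circ_metric A B C x a j) p = grad f p 0 i.
  by move=> /funext ->; rewrite [RHS]mxE.
by case: a j entry => -[|[|[|[|//]]]] ? [[|[|[|[|//]]]] ?] entry;
  rewrite [RHS]mxE /=; apply: entry => x; rewrite mxE.
Qed.

Lemma christoffel_circ_metric (R : realType) (A B C : 'rV[R]_4 -> R) i p :
  \matrix_(j, s) christoffel (circ_metric A B C) i j s p =
  2^-1 *: lowered (grad A p) (grad B p) (grad C p) i *m invmx (circ_metric A B C p).
Proof.
apply/matrixP => j s; rewrite [LHS]mxE [RHS]mxE /christoffel mulr_sumr.
apply: eq_bigr => a _; rewrite !partial_circ_metric mulrA.
by rewrite [(_ *: lowered _ _ _ _) _ _]mxE [lowered _ _ _ _ _ _]mxE.
Qed.

(** Constant components have zero derivative, so only the connection terms remain; with lower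
    indices as rows they are matrix products. *)
Lemma cov_deriv_cst (R : realType) n (g : 'rV[R]_n.+1 -> 'M[R]_n.+1)
    (Q : 'M[R]_n.+1) i p :
  \matrix_(j, s) cov_deriv g (fun=> Q) i j s p =
  let G := \matrix_(j, s) christoffel g i j s p in Q *m G - G *m Q.
Proof.
apply/matrixP => j s; rewrite !mxE /cov_deriv /partial derive_cst add0r.
by congr (_ - _); apply: eq_bigr => k _; rewrite !mxE // mulrC.
Qed.

Theorem theorem3p3 (R : realType) (F : set 'rV[R]_4) (A B C : 'rV[R]_4 -> R)
    (openF : open F)
    (smoothA : smooth_on F A) (smoothB : smooth_on F B) (smoothC : smooth_on F C)
    (ACB : forall p, F p -> [/\ A p > C p, C p > B p & B p > 0]) :
  (forall p, F p -> forall i j s : 'I_4,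
     cov_deriv (circ_metric A B C) (fun=> circ_q R) i j s p = 0)
  <->
  (forall p, F p ->
     grad A p = grad C p *m circ_q R ^+ 2 /\
     2 *: grad B p = grad C p *m (circ_q R + circ_q R ^+ 3)).
Proof.
(* The equivalence already holds at each point of [F] separately. *)
suff ptwise p : F p ->
    (forall i j s, cov_deriv (circ_metric A B C) (fun=> circ_q R) i j s p = 0) <->
    grad A p = grad C p *m circ_q R ^+ 2 /\
    2 *: grad B p = grad C p *m (circ_q R + circ_q R ^+ 3).
  by split=> H p Fp; apply/ptwise => //; apply: H.
move=> Fp; rewrite -circ_q_lowered.
set q := circ_q R; set g := circ_metric A B C p; set L := lowered _ _ _.
have gU : g \in unitmx by have [? ? ?] := ACB p Fp; apply: circ4_unit.
have qg : q *m g = g *m q by apply: circ_q_circ4.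
have qgV : q *m invmx g = invmx g *m q.
  by rewrite -[LHS](mulKmx gU) (mulmxA g) -qg -mulmxA mulmxV // mulmx1.
(* As q commutes with [invmx g], that invertible factor can be pulled out on the right. *)
have nablaE i :
    \matrix_(j, s) cov_deriv (circ_metric A B C) (fun=> q) i j s p =
    2^-1 *: (q *m L i - L i *m q) *m invmx g.
  rewrite cov_deriv_cst christoffel_circ_metric -/g -/L /=.
  rewrite -!scalemxAl -scalemxAr -scalerBr mulmxBl.
  by rewrite -!mulmxA qgV.
split=> [H i|H i j s].
  have : 2^-1 *: (q *m L i - L i *m q) *m invmx g = 0.
    by rewrite -nablaE; apply/matrixP => j s; rewrite !mxE H.
  move=> /(congr1 (fun M => M *m g)); rewrite mulmxKV // mul0mx => /eqP.
  by rewrite scaler_eq0 invr_eq0 pnatr_eq0 /= subr_eq0 => /eqP.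
have /matrixP/(_ j s) := nablaE i.
by rewrite H subrr scaler0 mul0mx !mxE.
Qed.
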